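(* Suppose that the system with disturbance $\dot z=f(z,u,d)$, $z=(z_1,z_2,z_c)$, has coupled control and disturbance of the form $\dot z_1=f_1(z_1,z_c,u,d)$, $\dot z_2=f_2(z_2,z_c,u,d)$, $\dot z_c=f_c(z_c,u,d)$. Let $t<0$. If the target sets satisfy $\mathcal T=\mathrm{proj}_1^{-1}(\mathcal T_1)\cap \mathrm{proj}_2^{-1}(\mathcal T_2)$, then the maximal backward reachable sets $\mathcal R(s)$ and maximal backward reachable tube $\bar{\mathcal R}(t)$ satisfy $$\bigcup_{s\in[t,0]}\mathcal R(s)\subseteq\bar{\mathcal R}(t).$$
   Context: System: $z\in\mathbb R^n$ evolves by the time-invariant ODE $\dot z=f(z,u,d)$ with control $u\in\mathcal U\subset\mathbb R^{n_u}$ ($\mathcal U$ compact) and disturbance $d\in\mathcal D\subset\mathbb R^{n_d}$ (bounded); $f$ is uniformly continuous, bounded, and Lipschitz in $z$ for fixed $(u,d)$. For an initial time $s\le 0$, control functions $u(\cdot)$ and disturbance functions $d(\cdot)$ are measurable functions from $[s,0]$ to $\mathcal U$ and $\mathcal D$, and $\zeta(r;z,s,u(\cdot),d(\cdot))$, $r\in[s,0]$, is the unique trajectory equal to $z$ at time $s$. The disturbance is given by a non-anticipative strategy $\gamma\in\Gamma(s)$: a map $u(\cdot)\mapsto\gamma[u](\cdot)$ from control functions to disturbance functions on $[s,0]$ such that whenever $u(r)=\hat u(r)$ for a.e. $r\in[s,\tau]$, then $\gamma[u](r)=\gamma[\hat u](r)$ for a.e. $r\in[s,\tau]$. State partition: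 $z=(z_1,z_2,z_c)$ with $z_i\in\mathbb R^{n_i}$, $z_c\in\mathbb R^{n_c}$, $n_1,n_2>0$, $n_c\ge 0$, $n_1+n_2+n_c=n$. Back-projection: for $S_i\subseteq\mathbb R^{n_i+n_c}$, $\mathrm{proj}_i^{-1}(S_i)=\{z\in\mathbb R^n:(z_i,z_c)\in S_i\}$. Target sets: $\mathcal T\subseteq\mathbb R^n$, $\mathcal T_i\subseteq\mathbb R^{n_i+n_c}$. Maximal backward reachable set: $\mathcal R(s)=\{z:\forall\gamma\in\Gamma(s),\ \exists u(\cdot),\ \zeta(0;z,s,u(\cdot),\gamma[u](\cdot))\in\mathcal T\}$ for $s\le 0$. Maximal backward reachable tube: $\bar{\mathcal R}(t)=\{z:\forall\gamma\in\Gamma(t),\ \exists u(\cdot),\ \exists s\in[t,0],\ \zeta(s;z,t,u(\cdot),\gamma[u](\cdot))\in\mathcal T\}$. *)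

(* Defs.v *)
(* MathComp-Analysis *)
From HB Require Import structures.
From mathcomp Require Export all_boot all_order all_algebra.
From mathcomp Require Export all_classical all_reals all_analysis.

Set Implicit Arguments.
Unset Strict Implicit.
Unset Printing Implicit Defensive.

Export Order.TTheory GRing.Theory Num.Theory.
Export numFieldNormedType.Exports.

Global Open Scope classical_set_scope.
Global Open Scope ring_scope.

(* Vectors of R^n are row vectors; a state z = (z1, z2, zc) is a row vector of
   width n1 + n2 + nc, parsed as (n1 + n2) + nc.  The library norm of 'rV[R]_n
   is the sup norm. *)

Definition sub1 (R : realType) (n1 n2 nc : nat) (z : 'rV[R]_(n1 + n2 + nc)) :
  'rV[R]_n1 := lsubmx (lsubmx z).

Definition sub2 (R : realType) (n1 n2 nc : nat) (z : 'rV[R]_(n1 + n2 + nc)) :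
  'rV[R]_n2 := rsubmx (lsubmx z).

Definition subc (R : realType) (n1 n2 nc : nat) (z : 'rV[R]_(n1 + n2 + nc)) :
  'rV[R]_nc := rsubmx z.

Definition backproj1 (R : realType) (n1 n2 nc : nat)
    (S1 : set 'rV[R]_(n1 + nc)) : set 'rV[R]_(n1 + n2 + nc) :=
  [set z | S1 (row_mx (sub1 z) (subc z))].

Definition backproj2 (R : realType) (n1 n2 nc : nat)
    (S2 : set 'rV[R]_(n2 + nc)) : set 'rV[R]_(n1 + n2 + nc) :=
  [set z | S2 (row_mx (sub2 z) (subc z))].

(* The Lipschitz constant may depend on (u, d); this includes the case of a
   constant uniform over U x D, for which trajectories are unique. *)
Definition regular_dynamics (R : realType) (n nu nd : nat)
    (U : set 'rV[R]_nu) (D : set 'rV[R]_nd)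
    (f : 'rV[R]_n -> 'rV[R]_nu -> 'rV[R]_nd -> 'rV[R]_n) : Prop :=
  let dom : set ('rV[R]_n * 'rV[R]_nu * 'rV[R]_nd) := (setT `*` U) `*` D in
  [/\ unif_continuous
        ((fun p => f p.1.1 p.1.2 p.2) : subspace dom -> 'rV[R]_n),
      [bounded f p.1.1 p.1.2 p.2 | p in dom] &
      forall u d, U u -> D d -> [lipschitz f z u d | z in setT]].

(* Measurable functions from [s, 0] to V.  They are represented by functions on
   the whole line whose values outside [s, 0] are unconstrained and never used;
   measurability of a vector-valued function is componentwise. *)
Definition signals (R : realType) (m : nat) (V : set 'rV[R]_m) (s : R) :
    set (R -> 'rV[R]_m) :=
  [set v : R -> 'rV[R]_m |
           (forall j, measurable_fun `[s, 0] (fun r => v r 0 j)) /\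
           (forall r, s <= r <= 0 -> V (v r))].

Definition ae_equal_on (R : realType) (m : nat) (a b : R)
    (v w : R -> 'rV[R]_m) : Prop :=
  {ae @lebesgue_measure R, forall r, a <= r <= b -> v r = w r}.

(* Gamma(s).  Taking tau = 0 shows that g u depends, up to a null set, only on
   the restriction of u to [s, 0]. *)
Definition nonanticipative_strategies (R : realType) (nu nd : nat)
    (U : set 'rV[R]_nu) (D : set 'rV[R]_nd) (s : R) :
    set ((R -> 'rV[R]_nu) -> (R -> 'rV[R]_nd)) :=
  [set g | (forall u, signals U s u -> signals D s (g u)) /\
           (forall u u' tau, signals U s u -> signals U s u' ->
              s <= tau <= 0 ->
              ae_equal_on s tau u u' -> ae_equal_on s tau (g u) (g u'))].

(* eta is a Caratheodory solution on [s, r] of eta' = f(eta, u, d) a.e. with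
   eta(s) = z, in integral form. *)
Definition is_trajectory (R : realType) (n nu nd : nat)
    (f : 'rV[R]_n -> 'rV[R]_nu -> 'rV[R]_nd -> 'rV[R]_n)
    (s r : R) (z : 'rV[R]_n) (u : R -> 'rV[R]_nu) (d : R -> 'rV[R]_nd)
    (eta : R -> 'rV[R]_n) : Prop :=
  forall i,
    (@lebesgue_measure R).-integrable `[s, r]
      (fun q => (f (eta q) (u q) (d q) 0 i)%:E) /\
    (forall q, s <= q <= r ->
       eta q 0 i = z 0 i +
         \int[@lebesgue_measure R]_(x in `[s, q]) f (eta x) (u x) (d x) 0 i).

(* zeta(r; z, s, u, d): the state reached at time r by the trajectory that
   starts from z at time s.  The set below is a singleton whenever the
   trajectory exists and is unique, see flowE; z is a dummy value otherwise. *)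
Definition flow (R : realType) (n nu nd : nat)
    (f : 'rV[R]_n -> 'rV[R]_nu -> 'rV[R]_nd -> 'rV[R]_n)
    (r : R) (z : 'rV[R]_n) (s : R)
    (u : R -> 'rV[R]_nu) (d : R -> 'rV[R]_nd) : 'rV[R]_n :=
  xget z [set x | exists2 eta, is_trajectory f s r z u d eta & eta r = x].

Definition max_BRS (R : realType) (n nu nd : nat)
    (U : set 'rV[R]_nu) (D : set 'rV[R]_nd)
    (f : 'rV[R]_n -> 'rV[R]_nu -> 'rV[R]_nd -> 'rV[R]_n)
    (T : set 'rV[R]_n) (s : R) : set 'rV[R]_n :=
  [set z | forall g, nonanticipative_strategies U D s g ->
     exists2 u, signals U s u & T (flow f 0 z s u (g u))].

Definition max_BRT (R : realType) (n nu nd : nat)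
    (U : set 'rV[R]_nu) (D : set 'rV[R]_nd)
    (f : 'rV[R]_n -> 'rV[R]_nu -> 'rV[R]_nd -> 'rV[R]_n)
    (T : set 'rV[R]_n) (t : R) : set 'rV[R]_n :=
  [set z | forall g, nonanticipative_strategies U D t g ->
     exists2 u, signals U t u &
       exists2 s, t <= s <= 0 & T (flow f s z t u (g u))].

Lemma flowE (R : realType) (n nu nd : nat)
    (f : 'rV[R]_n -> 'rV[R]_nu -> 'rV[R]_nd -> 'rV[R]_n)
    (s r : R) (z : 'rV[R]_n) (u : R -> 'rV[R]_nu) (d : R -> 'rV[R]_nd)
    (eta : R -> 'rV[R]_n) :
  s <= r <= 0 -> is_trajectory f s 0 z u d eta ->
  (forall eta', is_trajectory f s r z u d eta' -> eta' r = eta r) ->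
  flow f r z s u d = eta r.
Proof.
move=> /andP[sr r0] eta_traj uniq_eta; rewrite /flow.
have eta_r : is_trajectory f s r z u d eta.
  move=> i; have [int_eta eqn_eta] := eta_traj i; split.
    apply: integrableS int_eta => //.
    by apply: subset_itvl; rewrite bnd_simp.
  move=> q /andP[sq qr]; apply: eqn_eta.
  by rewrite sq (le_trans qr r0).
by case: xgetP => [_ -> [eta' /uniq_eta -> ->]|/(_ (eta r))[]] //; exists eta.
Qed.

(* Main.v *)
Require Import Defs.
From mathcomp Require Import measurable_realfun.

Set Implicit Arguments.
Unset Strict Implicit.
Unset Printing Implicit Defensive.

(** A backward reachable set asks to hit the target at the final time, after
    flowing for a duration [- s], while the tube of horizon [- t >= - s] only
    asks to hit it at some time.  As the dynamics do not depend on time, a state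
    of the set at [s] can be driven into the target by running the same motion
    early, from [t] to [t - s] instead of from [s] to [0]; the target is then
    met at time [t - s], which lies between [t] and [0].

    What has to be checked is that the disturbance gains nothing from the longer
    horizon.  A control starting at [s] is turned into a control starting at [t]
    by translating it and keeping it constant once it has run out ([advance]).
    Answering the advanced control with a strategy that starts at [t], and
    translating the answer back, is a non-anticipative strategy that starts at
    [s] ([nonanticipative_postpone]).  Membership in the set at [s] thus yields a
    control that beats the translated strategy, and the advanced version of this
    control beats the original one.

    Translations preserve trajectories because they preserve the Lebesgue
    measure ([is_trajectory_shift]).  Hence the two flows are selected from the
    same set of end points with the same default value, and they agree
    ([flow_shift]). *)

(** * Translation invariance of the Lebesgue measure *)

Section translation.
Context {R : realType}.
Local Notation mu := (@lebesgue_measure R).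
Implicit Types (c : R) (D : set R).

Lemma measurable_translation c D : measurable_fun D (fun x : R => x + c).
Proof. by apply: measurable_funD => //; exact: measurable_id. Qed.

Lemma measurable_shift c D :
  measurable D -> measurable ((fun x : R => x + c) @^-1` D).
Proof.
move=> mD; rewrite -[X in measurable X]setTI.
exact: measurable_translation.
Qed.

Lemma preimage_shift_itvcc c (a b : R) :
  (fun x : R => x + c) @^-1` `[a, b] = `[a - c, b - c]%classic.
Proof.
by apply/seteqP; split=> x /=; rewrite !in_itv/= lerBlDr lerBrDr.
Qed.

Lemma lebesgue_measure_shift c D : measurable D ->
  pushforward mu (fun x : R => x + c : measurableTypeR R) D = mu D.
Proof.
move=> mD; apply/esym/lebesgue_measure_unique => [|mshift _ [[a b]] _ <-|//].
  exact: measurable_translation.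
rewrite /= /pushforward (_ : _ @^-1` _ = `]a - c, b - c]%classic).
  rewrite !lebesgue_measure_itv/= !lte_fin ltrD2r.
  by case: ifP => // _; rewrite -!EFinB; rewrite opprB addrA subrK.
by apply/seteqP; split=> x /=; rewrite !in_itv/= ltrBlDr lerBrDr.
Qed.

(** The weakening from [P] to [Q] absorbs the translation of the interval over
    which an almost-everywhere statement is relativized. *)
Lemma ae_shift c (P Q : R -> Prop) : (forall x, P (x + c) -> Q x) ->
  {ae mu, forall x, P x} -> {ae mu, forall x, Q x}.
Proof.
move=> PQ [N [mN N0 PN]]; exists ((fun x : R => x + c) @^-1` N); split.
- exact: measurable_shift.
- by rewrite -[RHS]N0 -[RHS](lebesgue_measure_shift c).
- by move=> x /= nQx; apply: PN => /PQ.
Qed.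

Lemma measurable_fun_shift c D d (T : measurableType d) (h : R -> T) :
  measurable D -> measurable_fun D h ->
  measurable_fun ((fun x : R => x + c) @^-1` D) (fun x => h (x + c)).
Proof.
move=> mD mh; apply: (measurable_comp mD _ mh) => [_ [x Dx <-] //|].
exact: measurable_translation.
Qed.

Lemma ge0_integral_shift c D (h : R -> \bar R) :
  measurable D -> measurable_fun D h -> (forall x, 0 <= h x)%E ->
  (\int[mu]_(x in (fun x : R => (x + c)%R) @^-1` D) h (x + c)%R =
   \int[mu]_(x in D) h x)%E.
Proof.
move=> mD mh h0.
rewrite -[LHS](@ge0_integral_pushforward _ _ (measurableTypeR R)
  (measurableTypeR R) R (fun x : R => x + c) (measurable_translation (D := setT) c)
  lebesgue_measure D h)//.
apply: eq_measure_integral => [|mshift A mA _].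
  exact: measurable_translation.
exact: lebesgue_measure_shift.
Qed.

Lemma integral_shift c D (h : R -> \bar R) :
  measurable D -> measurable_fun D h ->
  (\int[mu]_(x in (fun x : R => (x + c)%R) @^-1` D) h (x + c)%R =
   \int[mu]_(x in D) h x)%E.
Proof.
move=> mD mh; rewrite integralE [RHS]integralE; congr (_ - _)%E.
- rewrite -(ge0_integral_shift c (h := h^\+%E))//; last first.
    exact: measurable_funepos.
  by apply: eq_integral => x _; rewrite !funeposE.
- rewrite -(ge0_integral_shift c (h := h^\-%E))//; last first.
    exact: measurable_funeneg.
  by apply: eq_integral => x _; rewrite !funenegE.
Qed.

Lemma integrable_shift c D (h : R -> \bar R) : measurable D ->
  mu.-integrable D h ->
  mu.-integrable ((fun x : R => x + c) @^-1` D) (fun x => h (x + c)).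
Proof.
move=> mD /integrableP[mh hoo]; apply/integrableP; split.
  exact: measurable_fun_shift.
rewrite (ge0_integral_shift c (h := fun x => `|h x|%E))//.
exact: measurableT_comp.
Qed.

End translation.

(** * Trajectories and flows of an autonomous system *)

Section autonomous.
Context (R : realType) (n nu nd : nat).
Variable f : 'rV[R]_n -> 'rV[R]_nu -> 'rV[R]_nd -> 'rV[R]_n.
Implicit Types (z : 'rV[R]_n) (u : R -> 'rV[R]_nu) (d : R -> 'rV[R]_nd).

(** The inputs only have to correspond on the time interval of the trajectory:
    this is what makes the continuation of a translated control harmless. *)
Lemma is_trajectory_shift (c s r : R) z u u' d d' (eta : R -> 'rV[R]_n) :
  (forall q, s <= q <= r -> u q = u' (q + c)) ->
  (forall q, s <= q <= r -> d q = d' (q + c)) ->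
  is_trajectory f s r z u d eta ->
  is_trajectory f (s + c) (r + c) z u' d' (fun q => eta (q - c)).
Proof.
move=> uu' dd' eta_traj i; have [int_f eta_eq] := eta_traj i.
have fE x : s + c <= x <= r + c ->
    f (eta (x - c)) (u' x) (d' x) = f (eta (x - c)) (u (x - c)) (d (x - c)).
  move=> /andP[sx xr]; have sxr : s <= x - c <= r by rewrite lerBrDr sx lerBlDr.
  by rewrite uu'// dd'// subrK.
have preE q : (fun x : R => x - c) @^-1` `[s, q - c] = `[s + c, q]%classic.
  by rewrite preimage_shift_itvcc opprK subrK.
split.
  have := integrable_shift (- c) (measurable_itv _) int_f.
  rewrite preimage_shift_itvcc opprK; apply: eq_integrable => // x.
  by rewrite inE/= in_itv/= => xsr; rewrite fE.
move=> q /andP[sq qr].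
rewrite eta_eq; last by rewrite lerBrDr sq lerBlDr.
have int_fq : (@lebesgue_measure R).-integrable `[s, q - c]
    (fun x => (f (eta x) (u x) (d x) 0 i)%:E).
  apply: integrableS int_f => //.
  by apply: subset_itvl; rewrite bnd_simp lerBlDr.
congr (_ + fine _).
rewrite -[LHS](integral_shift (- c))//=; last exact: measurable_int int_fq.
rewrite preE; apply: eq_integral => x; rewrite inE/= in_itv/= => /andP[sx xq].
by rewrite fE// sx (le_trans xq qr).
Qed.

(** Translation is a bijection between the two sets of trajectories, so that
    both flows choose from the same set of end points. *)
Lemma flow_shift (c s r : R) z u u' d d' :
  (forall q, s <= q <= r -> u q = u' (q + c)) ->
  (forall q, s <= q <= r -> d q = d' (q + c)) ->
  flow f r z s u d = flow f (r + c) z (s + c) u' d'.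
Proof.
move=> uu' dd'; rewrite /flow; congr xget.
apply/seteqP; split=> x [eta eta_traj <-].
  exists (fun q => eta (q - c)); last by rewrite addrK.
  exact: is_trajectory_shift eta_traj.
exists (fun q => eta (q - - c)); last by rewrite opprK.
rewrite -[s](addrK c) -[r](addrK c).
apply: is_trajectory_shift eta_traj => q /andP[sq qr].
- by rewrite uu' ?subrK// lerBrDr sq lerBlDr.
- by rewrite dd' ?subrK// lerBrDr sq lerBlDr.
Qed.

End autonomous.

(** * Changing the initial time of controls and strategies *)

Section advance.
Context (R : realType).
Implicit Types (c s t : R).

(** The values of a signal with initial time [s] are only constrained between
    [s] and [0], so a translated signal has to be continued after time [- c];
    its last value [v 0] is one that lies in the right set, and the minimum
    makes the continuation measurable. *)
Definition advance (m : nat) c (v : R -> 'rV[R]_m) : R -> 'rV[R]_m :=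
  fun q => v (Num.min (q + c) 0).

Lemma signals_advance (m : nat) (V : set 'rV[R]_m) c s v :
  s <= 0 -> signals V s v -> signals V (s - c) (advance c v).
Proof.
move=> s0 [mv Vv]; split=> [j|q /andP[sq q0]].
  apply: (measurable_comp (F := `[s, 0]) (f := fun q => v q 0 j)) => //.
    move=> _ [q + <-]; rewrite /= !in_itv/= => /andP[sq _].
    by rewrite le_min ge_min lexx orbT s0 -lerBlDr sq.
  apply: measurable_minr => //.
  exact: measurable_translation.
by apply: Vv; rewrite le_min ge_min lexx orbT s0 -lerBlDr sq.
Qed.

Definition postpone_strategy (nu nd : nat) c
    (g : (R -> 'rV[R]_nu) -> R -> 'rV[R]_nd) :
    (R -> 'rV[R]_nu) -> R -> 'rV[R]_nd :=
  fun v q => g (advance c v) (q - c).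

(** Two controls that agree up to [tau] have advanced versions that agree up to
    [tau - c].  As [tau <= 0], this is before they become constant: the
    continuation reveals nothing to the strategy ahead of time. *)
Lemma nonanticipative_postpone (nu nd : nat) (U : set 'rV[R]_nu)
    (D : set 'rV[R]_nd) c s g : 0 <= c -> s <= 0 ->
  nonanticipative_strategies U D (s - c) g ->
  nonanticipative_strategies U D s (postpone_strategy c g).
Proof.
move=> c0 s0 [gD gna]; split=> [v Uv|v w tau Uv Uw /andP[stau tau0] vw].
  have [mgv Dgv] := gD _ (signals_advance c s0 Uv); split=> [j|q /andP[sq q0]].
    apply: (@measurable_funS _ _ _ _ `[s, c]) => //.
      by apply: subset_itvl; rewrite bnd_simp.
    have := measurable_fun_shift (c := - c) (measurable_itv _) (mgv j).
    by rewrite preimage_shift_itvcc opprK subrK add0r.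
  by apply: Dgv; rewrite lerD2r sq subr_le0 (le_trans q0).
have : ae_equal_on (s - c) (tau - c) (g (advance c v)) (g (advance c w)).
  apply: gna; [exact: signals_advance|exact: signals_advance| |].
    by rewrite lerD2r stau subr_le0 (le_trans tau0).
  apply: (ae_shift (c := c)) vw => q vwq /andP[sq qtau].
  have {}qtau : q + c <= tau by rewrite -lerBrDr.
  rewrite /advance min_l ?(le_trans qtau)//.
  by apply: vwq; rewrite -lerBlDr sq.
apply: (ae_shift (c := - c)) => q gq /andP[sq qtau].
by apply: gq; rewrite !lerD2r sq.
Qed.

End advance.

(** The target is met inside the tube at time [t - s], which is the duration
    [- s] counted from [t]. *)
Lemma max_BRS_sub_max_BRT (R : realType) (n nu nd : nat)
    (U : set 'rV[R]_nu) (D : set 'rV[R]_nd)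
    (f : 'rV[R]_n -> 'rV[R]_nu -> 'rV[R]_nd -> 'rV[R]_n)
    (T : set 'rV[R]_n) (s t : R) : t <= s <= 0 ->
  max_BRS U D f T s `<=` max_BRT U D f T t.
Proof.
move=> /andP[ts s0] z zs g g_na; pose c := s - t.
have c0 : 0 <= c by rewrite subr_ge0.
have tE : t = s - c by rewrite /c opprB addrC subrK.
rewrite tE in g_na *.
have [v Uv Tv] := zs _ (nonanticipative_postpone c0 s0 g_na).
exists (advance c v); first exact: signals_advance.
exists (- c); first by rewrite gerDr s0 oppr_le0.
suff <- : flow f 0 z s v (postpone_strategy c g v) =
    flow f (- c) z (s - c) (advance c v) (g (advance c v)) by [].
rewrite -{1}[- c]add0r; apply: flow_shift => // q /andP[_ q0].
by rewrite /advance subrK min_l.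
Qed.

Theorem corollary9 (R : realType) (n1 n2 nc nu nd : nat)
    (n1_gt0 : (0 < n1)%N) (n2_gt0 : (0 < n2)%N)
    (U : set 'rV[R]_nu) (D : set 'rV[R]_nd)
    (U_compact : compact U) (D_bounded : bounded_set D)
    (f : 'rV[R]_(n1 + n2 + nc) -> 'rV[R]_nu -> 'rV[R]_nd ->
         'rV[R]_(n1 + n2 + nc))
    (f_regular : regular_dynamics U D f)
    (f1 : 'rV[R]_n1 -> 'rV[R]_nc -> 'rV[R]_nu -> 'rV[R]_nd -> 'rV[R]_n1)
    (f2 : 'rV[R]_n2 -> 'rV[R]_nc -> 'rV[R]_nu -> 'rV[R]_nd -> 'rV[R]_n2)
    (fc : 'rV[R]_nc -> 'rV[R]_nu -> 'rV[R]_nd -> 'rV[R]_nc)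
    (f_coupled : forall z u d, U u -> D d ->
       [/\ sub1 (f z u d) = f1 (sub1 z) (subc z) u d,
           sub2 (f z u d) = f2 (sub2 z) (subc z) u d &
           subc (f z u d) = fc (subc z) u d])
    (t : R) (t_lt0 : t < 0)
    (T : set 'rV[R]_(n1 + n2 + nc))
    (T1 : set 'rV[R]_(n1 + nc)) (T2 : set 'rV[R]_(n2 + nc))
    (T_eq : T = @backproj1 R n1 n2 nc T1 `&` @backproj2 R n1 n2 nc T2) :
  \bigcup_(s in `[t, 0]) max_BRS U D f T s `<=` max_BRT U D f T t.
Proof.
move=> z [s s_in z_s]; apply: max_BRS_sub_max_BRT z_s.
by move: s_in; rewrite /= in_itv.
Qed.
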